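(* When $X$ is a simplicial complex of rank $n \geq 0$, \begin{itemize} \item either $\Delta X = \emptyset$, and in this case $X$ is a discrete surface if and only if it is a normal pseudomanifold, \item or $\Delta X \neq \emptyset$, and $X$ is an $n$-PCM if and only if it is a normal pseudomanifold. \end{itemize} In other words, $n$-PCM's and discrete surfaces are a generalization of normal pseudomanifolds to posets.
   Context: Posets. For a poset $X$ with order $\le$ and $h\in X$, put $\alpha_X(h)=\{h'\in X: h'\le h\}$, $\beta_X(h)=\{h'\in X: h'\ge h\}$, $\theta_X(h)=\alpha_X(h)\cup\beta_X(h)$, and let $\alpha^{\square}_X(h),\beta^{\square}_X(h),\theta^{\square}_X(h)$ be these sets with $h$ removed. Any subset $S\subseteq X$ is regarded as a poset $|S|$ with the induced order. The rank $\mathrm{rk}(h,X)$ is $0$ if $\alpha^{\square}_X(h)=\emptyset$ and $1+\max_{x\in\alpha^{\square}_X(h)}\mathrm{rk}(x,X)$ otherwise; the rank of $X$ is the maximal rank of its elements, and $-1$ if $X=\emptyset$. A $k$-face of $X$ is an element of rank $k$. A path is a finite sequence $\langle p^0,\dots,p^k\rangle$ in $X$ with $p^i\in\theta^{\square}_X(p^{i-1})$ for $1\le i\le k$; $X$ is connected if any two elements are joined by a path in $X$. Discrete surfaces. A CF-order is a countable poset with all $\theta_X(h)$ finite. A CF-order $X$ is a (discrete) $(-1)$-surface if $X=\emptyset$; a (discrete) $0$-surface if $X=\{x,y\}$ with $x\neq y$ and $x\notin\theta^{\square}_X(y)$; and, for $k\ge1$, a (discrete) $k$-surface if it is non-empty,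 connected and $|\theta^{\square}_X(h)|$ is a $(k-1)$-surface for every $h\in X$. A discrete surface is a discrete $k$-surface for some $k$ (a discrete $k$-surface has rank $k$). Border and PCM's. The border of a poset $X$ of rank $n\ge0$ is $\Delta X=\{h\in X: |\theta^{\square}_X(h)| \text{ is not an } (n-1)\text{-surface}\}$. A poset $X$ of rank $n\ge -1$ is an $n$-PCM ($n$-dimensional poset-based connected manifold) if: $n=-1$ and $X=\emptyset$; or $n=0$ and $X$ is a singleton; or $n\ge1$, $X$ is connected, $\Delta X\ne\emptyset$, and for every $h\in X$, $|\theta^{\square}_X(h)|$ is either an $(n-1)$-surface (and $h\notin\Delta X$) or an $(n-1)$-PCM (and $h\in\Delta X$). Simplicial complexes. A simplex is a non-empty finite set $h$, of dimension $\dim(h)=\#h-1$. A simplicial complex is a finite set of simplices containing every non-empty subset of each of its elements (hence also every non-empty intersection of two of its elements); it is viewed as a poset ordered by inclusion, so that rank equals dimension. The link of $h\in X$ is $\mathrm{lk}(h,X)=\{h'\in X: h\cap h'=\emptyset,\ h\cup h'\in X\}$. Pseudomanifolds. A simplicial complex $X$ of rank $n\ge 0$ is a pseudomanifold if either $n=0$ and $X$ consists of one single element, or $n\ge1$ and: $X$ is pure, that is, every $h\in X$ is contained in an $n$-face of $X$; each $(n-1)$-face of $X$ is a face of one or two $n$-faces of $X$; and any two $n$-faces of $X$ are joined by a path consisting only of $(n-1)$-faces and $n$-faces of $X$. A pseudomanifold $X$ of rank $n\ge 0$ is normal if the link in $X$ of every face of dimension $d\le n-2$ is a pseudomanifold.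
   Formalization: The equivalence in the first bullet is stated only for n ≥ 1: at n = 0 it is false, since a single vertex has empty border and is a normal pseudomanifold but not a discrete surface (a 0-surface has two elements). *)

(* Defs.v *)
From HB Require Import structures.
From mathcomp Require Import all_boot all_order finmap.
From mathcomp Require Import boolp classical_sets cardinality.

Set Implicit Arguments.
Unset Strict Implicit.
Unset Printing Implicit Defensive.

Import Order.TTheory.
Local Open Scope classical_set_scope.

(* A poset is a subset [X] of an ambient partially ordered type [T], with the
   induced order. Dimensions start at -1: in [rankS], [surfaceS] and [pcmS]
   the index [m] stands for dimension [m - 1]. *)

Section Posets.
Context (d : Order.disp_t) (T : porderType d).
Implicit Types (X : set T) (h x y : T).

Definition alpha X h : set T := [set x | X x /\ (x <= h)%O].
Definition beta X h : set T := [set x | X x /\ (h <= x)%O].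
Definition theta X h : set T := alpha X h `|` beta X h.

Definition alphao X h : set T := alpha X h `\ h.
Definition thetao X h : set T := theta X h `\ h.

(* [rk X h k] reads rk(h, X) = k. It is a relation because the recursion need
   not be well-founded in an arbitrary poset. *)
Inductive rk X : T -> nat -> Prop :=
| rk_min h : alphao X h = set0 -> rk X h 0
| rk_succ h k (r : T -> nat) :
    (forall x, alphao X h x -> rk X x (r x)) ->
    (exists2 x, alphao X h x & r x = k) ->
    (forall x, alphao X h x -> r x <= k) ->
    rk X h k.+1.

Definition rankS (m : nat) X : Prop :=
  if m is n.+1 then
    (exists2 h, X h & rk X h n) /\
    (forall h, X h -> exists2 k, rk X h k & k <= n)
  else X = set0.

Definition has_rank (n : nat) X : Prop := rankS n.+1 X.

Definition face (k : nat) X : set T := [set h | X h /\ rk X h k].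

Definition path_in X x (p : seq T) : Prop :=
  X x /\ path (fun a b => b \in thetao X a) x p.

Definition poset_connected X : Prop :=
  forall x y, X x -> X y -> exists2 p, path_in X x p & last x p = y.

Definition CF_order X : Prop :=
  countable X /\ forall h, X h -> finite_set (theta X h).

Fixpoint surfaceS (m : nat) X : Prop :=
  CF_order X /\
  match m with
  | 0 => X = set0
  | 1 => exists x y, [/\ x != y, ~ thetao X y x & X = [set x; y]]
  | m'.+1 => [/\ X !=set0, poset_connected X &
              forall h, X h -> surfaceS m' (thetao X h)]
  end.

Definition discrete_surface X : Prop := exists m, surfaceS m X.

(* Meaningful when [X] has rank [n]; [surfaceS n] means (n-1)-surface. *)
Definition border (n : nat) X : set T :=
  [set h | X h /\ ~ surfaceS n (thetao X h)].

Fixpoint pcmS (m : nat) X : Prop :=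
  rankS m X /\
  match m with
  | 0 => X = set0
  | 1 => exists x, X = [set x]
  | n.+1 => [/\ poset_connected X, border n X !=set0 &
             forall h, X h ->
               (surfaceS n (thetao X h) /\ ~ border n X h) \/
               (pcmS n (thetao X h) /\ border n X h)]
  end.

Definition pcm (n : nat) X : Prop := pcmS n.+1 X.

End Posets.

Fact fset_display : Order.disp_t.
Proof. exact: Order.Disp tt tt. Qed.

Section FsetOrder.
Context (V : choiceType).
Implicit Types A B C : {fset V}.

Let lt_def A B : (A `<` B)%fset = (B != A) && (A `<=` B)%fset.
Proof. by rewrite fproperEneq eq_sym. Qed.

Let le_refl : reflexive (@fsubset V).
Proof. by move=> A; exact: fsubset_refl. Qed.

Let le_anti : antisymmetric (@fsubset V).
Proof. by move=> A B ?; apply/eqP; rewrite eqEfsubset. Qed.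

Let le_trans : transitive (@fsubset V).
Proof. by move=> B A C; exact: fsubset_trans. Qed.

HB.instance Definition _ := Order.isPOrder.Build
  fset_display {fset V} lt_def le_refl le_anti le_trans.

End FsetOrder.

Section Complexes.
Context (V : choiceType).
Implicit Types (X : {fset {fset V}}) (h : {fset V}).

Definition simplicial_complex X : Prop :=
  (forall h, h \in X -> h != fset0) /\
  (forall h h', h \in X -> (h' `<=` h)%fset -> h' != fset0 -> h' \in X).

Definition sdim h : nat := #|` h|.-1.

Definition link X h : {fset {fset V}} :=
  [fset h' in X | fdisjoint h h' && ((h `|` h')%fset \in X)]%fset.

Definition cofaces (n : nat) X (f : {fset V}) : set {fset V} :=
  face n [set` X] `&` [set s | (f `<=` s)%fset].

Definition pseudomanifold (n : nat) X : Prop :=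
  [/\ simplicial_complex X, has_rank n [set` X] &
   if n is n'.+1 then
     [/\ forall h, h \in X -> exists2 s, face n [set` X] s & (h `<=` s)%fset,
         forall f, face n' [set` X] f ->
           (exists s, cofaces n X f = [set s]) \/
           (exists s t, s != t /\ cofaces n X f = [set s; t]) &
         forall s t, face n [set` X] s -> face n [set` X] t ->
           exists p, [/\ path_in [set` X] s p, last s p = t &
             forall u, u \in p -> face n' [set` X] u \/ face n [set` X] u]]
   else exists h, X = [fset h]%fset].

(* The links of a complex carry no prescribed rank, hence the [exists m]. *)
Definition normal_pseudomanifold (n : nat) X : Prop :=
  pseudomanifold n X /\
  forall h, h \in X -> sdim h + 2 <= n ->
    exists m, pseudomanifold m (link X h).

End Complexes.

(* Main.v *)
Require Import Defs.
From mathcomp Require Import all_boot all_order finmap.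
From mathcomp Require Import boolp classical_sets cardinality.
From mathcomp Require Import zify.

Local Open Scope classical_set_scope.

(** The definitions of a surface and of a PCM have the same shape: non-empty,
    connected, and every [thetao X h] again of the kind, one dimension lower.
    They differ in where the recursion bottoms out: two points for a surface,
    and also one point for a PCM. Merging the two cases gives a single
    recursive notion, [mfdS], which permits both; in positive dimension, a
    finite [mfdS] poset is a surface when its border is empty and a PCM otherwise
    ([mfdS_surfaceS_pcmS]). The theorem then reduces to one equivalence: for
    n >= 1, a simplicial complex of rank n is [mfdS n.+1] if and only if it is
    a normal pseudomanifold.

    The bridge between the posets [thetao X h] and the links is a join
    decomposition. Every element below h precedes every element above h, so
    [thetao X h] is the join of [alphao X h], the boundary of the simplex h,
    and of [betao X h], which is isomorphic to the link of h. Boundaries of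
    simplices are [mfdS] ([mfdS_bdry]). A join of [mfdS] posets is [mfdS]
    ([mfdS_join]), and conversely an [mfdS] factor can be cancelled from an
    [mfdS] join ([mfdS_join_inv]). Hence [thetao X h] is [mfdS] of the expected
    dimension exactly when the link of h is.

    From [mfdS] to normal pseudomanifold ([mfdS_normal]): purity holds because
    every maximal element of an [mfdS] poset has top rank; the condition on
    codimension-one faces says that their links have one or two points; and
    strong connectedness comes by induction from the links, since a path of
    faces can be replaced, one face at a time, by a path of ridges and facets
    inside the star of that face. Normality holds because links are [mfdS] too.
    In the other direction ([normal_mfdS]), the link of a face of a normal
    pseudomanifold is again a normal pseudomanifold, since a link in a link is
    a link, and induction on the dimension applies. *)

(** * Comparability paths *)

Section Paths.
Set Implicit Arguments.
Unset Strict Implicit.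
Import Order.TTheory.
Context (d : Order.disp_t) (T : porderType d).
Implicit Types (X Y A B : set T) (h x y z : T).

Lemma alphaoE X h x : alphao X h x <-> X x /\ (x < h)%O.
Proof.
split; first by move=> [[Xx xh] /eqP nxh]; rewrite lt_neqAle nxh.
by move=> [Xx xh]; split; [split=> //; exact: ltW | apply/eqP; rewrite lt_eqF].
Qed.

Definition betao X h : set T := [set x | X x /\ (h < x)%O].

Lemma thetaoE X h x : thetao X h x <-> X x /\ ((x < h)%O \/ (h < x)%O).
Proof.
split.
  by move=> [[[Xx xh]|[Xx xh]] /eqP nxh]; split=> //; [left|right];
    rewrite lt_neqAle ?nxh // eq_sym nxh.
move=> [Xx [lt|lt]]; (split; last by [apply/eqP; rewrite lt_eqF|
  apply/eqP; rewrite gt_eqF]).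
  by left; split=> //; exact: ltW.
by right; split=> //; exact: ltW.
Qed.

Lemma thetaoU X h : thetao X h = alphao X h `|` betao X h.
Proof.
apply/seteqP; split=> x.
  by move/thetaoE=> [Xx [xh|xh]]; [left; apply/alphaoE|right].
by move=> [/alphaoE|] [Xx xh]; apply/thetaoE; split; auto.
Qed.

Lemma thetao_sub X h : thetao X h `<=` X.
Proof. by move=> x /thetaoE[]. Qed.

Definition joined Y x y : Prop := exists2 p, path_in Y x p & last x p = y.

Lemma joined_refl Y x : Y x -> joined Y x x.
Proof. by exists [::]. Qed.

Lemma joined_trans Y x y z : joined Y x y -> joined Y y z -> joined Y x z.
Proof.
move=> [p [Yx xp] <-] [q [_ yq] <-]; exists (p ++ q); last by rewrite last_cat.
by split=> //; rewrite cat_path xp.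
Qed.

Lemma joined_le Y x y : Y x -> Y y -> (x <= y)%O -> joined Y x y /\ joined Y y x.
Proof.
move=> Yx Yy; rewrite le_eqVlt => /orP[/eqP<-|xy].
  by split; exact: joined_refl.
by split; [exists [:: y]|exists [:: x]] => //; split=> //=; rewrite andbT inE;
  apply/thetaoE; auto.
Qed.

(** The path is eliminated through its steps only. Asking for both [R x y] and
    [R y x] when [x < y] spares a case distinction on the direction of a step. *)
Lemma joined_ind Y (R : T -> T -> Prop) :
    (forall x, Y x -> R x x) ->
    (forall x y z, R x y -> R y z -> R x z) ->
    (forall x y, Y x -> Y y -> (x < y)%O -> R x y /\ R y x) ->
  forall x y, joined Y x y -> R x y.
Proof.
move=> Rr Rt Rs x y [p [Yx]].
elim: p x Yx => [|z p IHp] x Yx /=; first by move=> _ <-; exact: Rr.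
move=> /andP[/set_mem/thetaoE[Yz xz] zp] eqy.
apply: (Rt x z y); last exact: IHp.
by case: xz => lt; have [] := Rs _ _ _ _ lt.
Qed.

(** In a pseudomanifold, the paths between facets live in X while their
    elements are constrained one by one; they are the paths of the subposet of
    admissible elements, and [joined] in that subposet is easier to compose and
    to transport. *)
Lemma path_in_joined X (S : set T) s t : X s -> S s ->
  joined (X `&` S) s t <->
  exists p, [/\ path_in X s p, last s p = t & forall u, u \in p -> S u].
Proof.
move=> Xs Ss; split.
  move=> [p [_ pp] eqt]; exists p; rewrite /path_in; split=> //.
    split=> //; apply: sub_path pp => a b; rewrite !inE.
    by move=> /thetaoE[[Xb _] ab]; apply/thetaoE.
  elim: p s {Xs Ss eqt} pp => [|a p IHp] s //=.
  move=> /andP[/set_mem/thetaoE[[_ Sa] _] ap] u; rewrite in_cons => /orP[/eqP->//|].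
  exact: IHp ap _.
move=> [p [[_ pp] eqt Sp]]; exists p => //; split=> //.
elim: p s {Xs Ss eqt} pp Sp => [|a p IHp] s //=.
move=> /andP[/set_mem/thetaoE[Xa sa] ap] Sp.
rewrite IHp // ?andbT; last by move=> u up; apply: Sp; rewrite in_cons up orbT.
by apply/mem_set/thetaoE; do !split=> //; apply: Sp; exact: mem_head.
Qed.

End Paths.

Lemma joined_map (d d' : Order.disp_t) (T : porderType d) (T' : porderType d')
    (Y : set T) (Z : set T') (f : T -> T') :
    (forall x, Y x -> Z (f x)) ->
    (forall x y, Y x -> Y y -> (x < y)%O -> (f x <= f y)%O) ->
  forall x y, joined Y x y -> joined Z (f x) (f y).
Proof.
move=> YZ mf; apply: joined_ind => [x /YZ Zx|x y z|x y Yx Yy xy].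
- exact: joined_refl.
- exact: joined_trans.
- by apply: joined_le; auto.
Qed.

(** * Surfaces and PCMs as one recursive notion *)
Section Manifolds.
Set Implicit Arguments.
Unset Strict Implicit.
Import Order.TTheory.
Context (d : Order.disp_t) (T : porderType d).
Implicit Types (X Y A B : set T) (h x y z : T) (m n : nat).

(** As in [surfaceS] and [pcmS], the index is the dimension plus one. For the
    index 1, x and y may coincide, which merges the one-point PCM with the
    two-point surface; they are incomparable because [thetao X h] is empty for
    each h in X. *)
Fixpoint mfdS (m : nat) X : Prop :=
  if m is m'.+1 then
    [/\ X !=set0, forall h, X h -> mfdS m' (thetao X h) &
        if m' is 0 then exists x y, X = [set x; y] else poset_connected X]
  else X = set0.

Lemma surfaceS_mfdS m X : surfaceS m X -> mfdS m X.
Proof.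
elim: m X => [|[|m] IHm] X /=; first by case.
  move=> [_ [x [y [_ nyx XE]]]]; subst X; split; first by exists x; left.
    move=> h hxy; apply/seteqP; split=> // z /thetaoE[zxy lt].
    apply: nyx; apply/thetaoE; split; first by left.
    by case: hxy lt => ->; case: zxy => ->; rewrite ?ltxx => -[]//; auto.
  by exists x, y.
by move=> [_ [X0 Xc Xt]]; split=> // h /Xt; exact: IHm.
Qed.

Lemma pcmS_mfdS m X : pcmS m X -> mfdS m X.
Proof.
elim: m X => [|[|m] IHm] X; first by case.
  move=> [_ [x ->]]; split; first by exists x.
    move=> h /= ->; apply/seteqP; split=> // z /thetaoE[/= ->].
    by rewrite ltxx; case.
  by exists x, x; rewrite setUid.
move=> [_ [Xc [h [Xh _]] Xt]]; split=> //; first by exists h.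
by move=> g /Xt[[/surfaceS_mfdS]|[/IHm]].
Qed.

Definition maximal X g : Prop := X g /\ forall x, X x -> ~ (g < x)%O.

(** The index bounds the length of chains: an h that is not maximal has a
    strict upper bound, which lies in [thetao X h], of smaller index; a maximal
    element of [thetao X h] above h is also maximal in X. *)
Lemma mfdS_maximal m X h : mfdS m X -> X h ->
  exists2 g, maximal X g & (h <= g)%O.
Proof.
elim: m X h => [|m IHm] X h; first by move=> ->.
move=> [_ Xt _] Xh.
have [[x [Xx hx]]|max] := pselect (exists x, X x /\ (h < x)%O); last first.
  by exists h => //; split=> // x Xx hx; apply: max; exists x.
have [||g [/thetaoE[Xg _] gmax] xg] := IHm (thetao X h) x; first exact: Xt.
  by apply/thetaoE; auto.
have hg : (h < g)%O by exact: lt_le_trans xg.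
exists g; last exact: ltW.
split=> // y Xy gy; apply: gmax (gy); apply/thetaoE; split=> //; right.
exact: lt_trans gy.
Qed.

Lemma rk_inj X h k l : rk X h k -> rk X h l -> k = l.
Proof.
move=> hk; elim: hk l => {h k} [h h0 l hl|h k r _ IHr [x hx rx] ler l hl].
  by case: hl h0 => // {}h {}l r _ [x hx _] _; rewrite -[_ = set0]/(_ = _) => h0;
    rewrite h0 in hx.
case: hl IHr hx ler => [{}h h0 _|{}h {}l r' r'P [x' hx' rx'] ler' IHr] hx ler.
  by rewrite h0 in hx.
have E y : alphao X h y -> r y = r' y by move=> hy; apply: IHr (r'P _ hy).
congr _.+1; apply/eqP; rewrite eqn_leq -{1}rx E // ler' //=.
by rewrite -{1}rx' -E // ler.
Qed.

Lemma rankS_inj m n X : rankS m X -> rankS n X -> m = n.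
Proof.
case: m n => [|m] [|n] //=;
  try by [move=> -> [[]]|move=> [[h Xh _] _] X0; rewrite X0 in Xh].
move=> [[h Xh hm] mP] [[g Xg gn] nP]; congr _.+1.
have [k hk kn] := nP _ Xh; have [l gl lm] := mP _ Xg.
by rewrite (rk_inj hm hk) in lm *; rewrite (rk_inj gn gl) in kn *; lia.
Qed.

(** The rank of an element only sees what lies below it. *)
Lemma rk_down X A h k : (forall x, A x -> X x) ->
    (forall x y, A y -> X x -> (x < y)%O -> A x) ->
  A h -> rk A h k -> rk X h k.
Proof.
move=> AX Ad Ah hk; have E y : A y -> alphao A y = alphao X y.
  move=> Ay; apply/seteqP; split=> x /alphaoE[xA xy]; apply/alphaoE; split=> //.
    exact: AX.
  exact: Ad xy.
elim: hk Ah => {h k} [h h0|h k r _ IHr ex le] Ah.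
  by apply: rk_min; rewrite -E.
rewrite E // in IHr ex le.
apply: (@rk_succ _ _ _ _ _ r) => // x hx; apply: IHr => //.
by move: hx; rewrite -E // => /alphaoE[].
Qed.

(** A maximal g satisfies [thetao X g = alphao X g], a lower set of X that is
    [mfdS] of the preceding index, so by induction it reaches exactly the rank
    before that of g. The bound for the other elements follows because each of
    them lies below some maximal element. *)
Lemma mfdS_rk m X : mfdS m.+1 X ->
  (forall h, X h -> exists2 k, rk X h k & k <= m) /\
  (forall g, maximal X g -> rk X g m).
Proof.
elim: m X => [|m IHm] X MX.
  have rk0 g : X g -> rk X g 0.
    case: (MX) => _ Xt _ /Xt /= t0; apply: rk_min; apply/seteqP; split=> // x gx.
    by rewrite -t0 thetaoU; left.
  by split=> [h /rk0|g []//]; first exists 0; auto.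
have Xt h : X h -> mfdS m.+1 (thetao X h) by case: MX => _ + _; exact.
have rkA g : maximal X g -> 
  [/\ (forall h, X h -> (h < g)%O -> exists2 k, rk X h k & k <= m) &
      exists h, [/\ X h, (h < g)%O & rk X h m]].
  move=> [Xg gmax]; have Mg := Xt _ Xg; have [rk1 rk2] := IHm _ Mg.
  (* since g is maximal, the elements comparable with g are those below it *)
  have thE x : thetao X g x <-> X x /\ (x < g)%O.
    split; first by move=> /thetaoE[Xx [|/gmax]] //; auto.
    by move=> [Xx xg]; apply/thetaoE; auto.
  have rkX h k : thetao X g h -> rk (thetao X g) h k -> rk X h k.
    apply: rk_down => [x /thE[]//|x y /thE[Xy yg] Xx xy]; apply/thE; split=> //.
    exact: lt_trans yg.
  split=> [h Xh hg|].
    have hA : thetao X g h by apply/thE.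
    by have [k hk km] := rk1 _ hA; exists k => //; exact: rkX.
  have [[x gx] _ _] := Mg; have [h hmax _] := mfdS_maximal Mg gx.
  have hA : thetao X g h by case: hmax.
  have [Xh hg] := (thE h).1 hA.
  by exists h; split=> //; apply: rkX => //; exact: rk2.
have rkM g : maximal X g -> rk X g m.+1.
  move=> /rkA[rkg [h [Xh hg hm]]].
  pose P x k := alphao X g x -> rk X x k /\ k <= m.
  (* [rk_succ] wants ranks given by a total function; [P] is only constrained
     below g, any value does elsewhere *)
  have /choice[r rP] : forall x, exists k, P x k.
    move=> x; have [/alphaoE[Xx xg]|nx] := pselect (alphao X g x); last by exists 0.
    by have [k ? ?] := rkg _ Xx xg; exists k.
  have gh : alphao X g h by apply/alphaoE.
  apply: (@rk_succ _ _ _ _ _ r) => [x /rP[]//||x /rP[]//].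
  by exists h => //; have [rh _] := rP _ gh; exact: rk_inj rh hm.
split=> // h Xh; have [g gmax] := mfdS_maximal MX Xh.
rewrite le_eqVlt => /orP[/eqP->|hg]; first by exists m.+1; auto.
by have [rkg _] := rkA _ gmax; have [k ? ?] := rkg _ Xh hg; exists k => //; lia.
Qed.

Lemma mfdS_rankS m X : mfdS m X -> rankS m X.
Proof.
case: m => [//|m] MX; have [rk1 rk2] := mfdS_rk MX; split=> //.
have [[x Xx] _ _] := MX; have [g gmax _] := mfdS_maximal MX Xx.
by exists g; [case: gmax|exact: rk2].
Qed.

Lemma finite_CF_order X : finite_set X -> CF_order X.
Proof.
move=> Xf; split; first exact: finite_set_countable.
by move=> h Xh; apply: sub_finite_set Xf => x [[]|[]].
Qed.

(** If all the [thetao X h] are surfaces then X is a surface. Otherwise the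
    border is non-empty, and an h on it has for [thetao X h] an [mfdS] poset
    that is not a surface, hence a PCM by induction. *)
Lemma mfdS_surfaceS_pcmS m X : finite_set X -> mfdS m X ->
  surfaceS m X \/ pcmS m X.
Proof.
elim: m X => [|[|m] IHm] X Xf MX.
- by left; split=> //; exact: finite_CF_order.
- have rX := mfdS_rankS MX; case: MX => _ Xt [x [y XE]].
  have [xy|/eqP nxy] := pselect (x = y).
    by right; split=> //; exists x; rewrite XE xy setUid.
  left; split; first exact: finite_CF_order.
  have Xy : X y by rewrite XE; right.
  by exists x, y; split=> //; have /= -> := Xt _ Xy.
have rX := mfdS_rankS MX; case: MX => X0 Xt Xc.
have [allS|/existsNP[h /not_implyP[Xh nS]]] :=
    pselect (forall h, X h -> surfaceS m.+1 (thetao X h)).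
  by left; split=> //; exact: finite_CF_order.
right; split=> //; split=> //; first by exists h.
move=> g Xg; have [gS|gP] := pselect (surfaceS m.+1 (thetao X g)).
  by left; split=> // -[].
right; split=> //.
case: (IHm (thetao X g)) => //; last exact: Xt.
by apply: sub_finite_set Xf; exact: thetao_sub.
Qed.

(** * Joins of posets *)
Definition below A B : Prop := forall a b, A a -> B b -> (a < b)%O.

Lemma thetao_joinl A B x : below A B -> A x ->
  thetao (A `|` B) x = thetao A x `|` B.
Proof.
move=> AB Ax; apply/seteqP; split=> z.
  by move=> /thetaoE[[Az|Bz] lt]; [left; apply/thetaoE|right].
move=> [/thetaoE[Az lt]|Bz]; apply/thetaoE; split; auto; [by left|by right].
Qed.

Lemma thetao_joinr A B y : below A B -> B y ->
  thetao (A `|` B) y = A `|` thetao B y.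
Proof.
move=> AB By; apply/seteqP; split=> z.
  by move=> /thetaoE[[Az|Bz] lt]; [left|right; apply/thetaoE].
move=> [Az|/thetaoE[Bz lt]]; apply/thetaoE; split; auto; [by left|by right].
Qed.

(** All pairs of elements are linked through one fixed element of B. *)
Lemma join_connected A B : A !=set0 -> B !=set0 -> below A B ->
  poset_connected (A `|` B).
Proof.
move=> [a Aa] [b Bb] AB.
suff jb z : (A `|` B) z -> joined (A `|` B) z b /\ joined (A `|` B) b z.
  by move=> x y /jb[xb _] /jb[_ yb]; exact: joined_trans xb yb.
have step x y : A x -> B y -> joined (A `|` B) x y /\ joined (A `|` B) y x.
  by move=> Ax By; apply: joined_le; [left|right|exact/ltW/AB].
move=> [Az|Bz]; first exact: step.
have [ab ba] := step _ _ Aa Bb; have [ax xa] := step _ _ Aa Bz.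
by split; [exact: joined_trans xa ab|exact: joined_trans ba ax].
Qed.

(** For an element x of one factor, [thetao] of the join at x is again a join:
    that factor is replaced by its own [thetao] at x, of index one less, and the
    other factor is unchanged. *)
Lemma mfdS_join m n A B : below A B -> mfdS m A -> mfdS n B ->
  mfdS (m + n) (A `|` B).
Proof.
elim: m n A B => [|m IHm] n A B; first by move=> _ -> ?; rewrite set0U.
elim: n A B => [|n IHn] A B AB MA MB; first by rewrite MB setU0 addn0.
rewrite addSn addnS; case: (MA) (MB) => A0 At _ [B0 Bt _]; split.
- by have [a Aa] := A0; exists a; left.
- move=> h [Ah|Bh].
    rewrite thetao_joinl // -addnS; apply: IHm => //; last exact: At.
    by move=> a b /thetaoE[Aa _]; exact: AB.
  rewrite thetao_joinr // -addSn; apply: IHn => //; last exact: Bt.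
  by move=> a b Aa /thetaoE[Bb _]; exact: AB.
- exact: join_connected.
Qed.

(** Passing to [thetao] along a maximal chain of A removes A altogether and
    leaves B, at the cost of one index per element of the chain. *)
Lemma mfdS_join_inv m n A B : below A B -> mfdS m (A `|` B) -> mfdS n A ->
  mfdS (m - n) B.
Proof.
elim: n m A => [|n IHn] m A AB MAB MA; first by move: MAB; rewrite MA set0U subn0.
have [[x Ax] At _] := MA; case: m MAB => [AB0|m [_ ABt _]].
  by have : (A `|` B) x by [left]; rewrite AB0.
rewrite subSS; apply: IHn (At _ Ax).
  by move=> a b /thetaoE[Aa _]; exact: AB.
by rewrite -thetao_joinl //; apply: ABt; left.
Qed.

End Manifolds.

(** [mfdS] only depends on the strict order, so it is carried along any map
    that preserves and reflects it. *)
Lemma mfdS_image (d d' : Order.disp_t) (T : porderType d) (T' : porderType d')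
    (f : T -> T') (m : nat) (X : set T) :
    (forall x y, X x -> X y -> (f x < f y)%O = (x < y)%O) ->
  mfdS m X -> mfdS m [set f x | x in X].
Proof.
elim: m X => [|m IHm] X fX; first by move=> ->; rewrite image_set0.
move=> [[x Xx] Xt Xm]; split; first by exists (f x); exists x.
  move=> _ [h Xh <-]; suff -> : thetao [set f x | x in X] (f h) =
      [set f x | x in thetao X h].
    by apply: IHm (Xt _ Xh) => y z /thetaoE[Xy _] /thetaoE[Xz _]; exact: fX.
  apply/seteqP; split=> y.
    move=> /thetaoE[[z Xz <-]]; rewrite !fX // => lt.
    by exists z => //; apply/thetaoE.
  move=> [z /thetaoE[Xz lt] <-]; apply/thetaoE; rewrite !fX //; split=> //.
  by exists z.
case: m Xm {IHm Xt} => [[y [z ->]]|m Xc].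
  by exists (f y), (f z); rewrite image_setU !image_set1.
move=> _ _ [y Xy <-] [z Xz <-].
apply: (@joined_map _ _ _ _ X); [by move=> u Xu; exists u| |exact: Xc].
by move=> u v Xu Xv uv; rewrite Order.POrderTheory.ltW // fX.
Qed.

(** * Boundaries of simplices *)
Section Simplices.
Set Implicit Arguments.
Unset Strict Implicit.
Import Order.TTheory.
Context (V : choiceType).
Implicit Types (S : set {fset V}) (g h x y : {fset V}) (m : nat).
Local Open Scope fset_scope.

Lemma fsubset_addr g x y : [disjoint g & x] -> (x `|` g `<=` y `|` g) = (x `<=` y).
Proof.
move=> /fdisjointP gx; apply/fsubsetP/fsubsetP => xy v vx.
  have := xy v; rewrite !in_fsetU vx => /(_ isT)/orP[//|vg].
  by have := gx v vg; rewrite vx.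
by move: vx; rewrite !in_fsetU => /orP[/xy->//|->]; rewrite orbT.
Qed.

Lemma fproper_addr g x y : [disjoint g & x] -> [disjoint g & y] ->
  (x `|` g `<` y `|` g) = (x `<` y).
Proof. by move=> gx gy; rewrite /fproper !fsubset_addr. Qed.

Lemma fdisjointDr g x : [disjoint g & x `\` g].
Proof. by apply/fdisjointP => v vg; rewrite in_fsetD vg. Qed.

Lemma fsetDUK g x : g `<=` x -> (x `\` g) `|` g = x.
Proof. by move=> gx; rewrite fsetUC fsetUDl fsetDv fsetD0; apply/fsetUidPr. Qed.

Lemma fsetUDK g x : [disjoint g & x] -> (x `|` g) `\` g = x.
Proof.
by move=> gx; rewrite fsetDUl fsetDv fsetU0; apply/fsetDidPl; rewrite fdisjoint_sym.
Qed.

Lemma card_fsetU_disj g x : [disjoint g & x] -> #|` x `|` g| = (#|` x| + #|` g|)%N.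
Proof.
by rewrite fdisjoint_sym => gx; rewrite cardfsU (disjoint_fsetI0 gx) cardfs0 subn0.
Qed.

(** Adding g is an isomorphism from the faces disjoint from g onto its image;
    it is how the upper part of a face is compared with its link. *)
Lemma mfdS_addr m g S : (forall x, S x -> [disjoint g & x]) ->
  mfdS m S <-> mfdS m [set (x `|` g)%fset | x in S]%classic.
Proof.
move=> gS; split.
  by apply: mfdS_image => x y /gS gx /gS gy; exact: fproper_addr.
move=> MS; suff -> :
    S = [set (x `\` g)%fset | x in [set (x `|` g)%fset | x in S]]%classic.
  apply: mfdS_image MS => _ _ [x /gS gx <-] [y /gS gy <-].
  by rewrite !fsetUDK //; apply/esym; exact: fproper_addr.
rewrite image_comp; apply/seteqP; split=> x.
  by move=> Sx; exists x => //=; rewrite fsetUDK //; exact: gS.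
by move=> [y Sy <-] /=; rewrite fsetUDK //; exact: gS.
Qed.

Lemma mfdS_1 S x y : S = [set x; y]%classic ->
  (forall a b, S a -> S b -> ~~ (a < b)%O) -> mfdS 1 S.
Proof.
move=> SE nlt; split; [by exists x; rewrite SE; left| |by exists x, y].
move=> h Sh; apply/seteqP; split=> // z /thetaoE[Sz [lt|lt]].
  by have := nlt _ _ Sz Sh; rewrite lt.
by have := nlt _ _ Sh Sz; rewrite lt.
Qed.

Definition bdry h : set {fset V} := [set x | x != fset0 /\ x `<` h].

Lemma alphao_bdry h g : bdry h g -> alphao (bdry h) g = bdry g.
Proof.
move=> [g0 gh]; apply/seteqP; split=> x; first by move=> /alphaoE[[x0 _] xg].
by move=> [x0 xg]; apply/alphaoE; do !split=> //; exact: (@lt_trans _ {fset V} g).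
Qed.

Lemma bdry_disj h g x : bdry (h `\` g) x -> [disjoint g & x].
Proof. by move=> [_ /fproper_sub xh]; exact: fdisjointWr xh (fdisjointDr g h). Qed.

Lemma betao_bdry h g : bdry h g ->
  betao (bdry h) g = [set (x `|` g)%fset | x in bdry (h `\` g)%fset]%classic.
Proof.
move=> [g0 gh]; have gh' := fproper_sub gh; apply/seteqP; split=> y.
  move=> [[y0 yh] gy]; have gy' := fproper_sub gy.
  exists (y `\` g); last exact: fsetDUK.
  split; first by rewrite fsetD_eq0; case/andP: gy.
  by rewrite -(@fproper_addr g) ?fdisjointDr // !fsetDUK.
move=> [x hx <-]; have gx := bdry_disj hx; have [x0 xh] := hx; split; first split.
- by rewrite fsetU_eq0 negb_and x0.
- by rewrite -(fsetDUK gh') fproper_addr ?fdisjointDr.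
- change (g `<` x `|` g); rewrite -{1}(fset0U g) fproper_addr ?fproper0 //.
  exact: fdisjointX0.
Qed.

(** Each face contains a vertex, and two vertices a, b are linked by the edge
    they span, which is a proper face as soon as h has three vertices. *)
Lemma bdry_connected h : 2 < #|` h| -> poset_connected (bdry h).
Proof.
move=> h3; have small z : z != fset0 -> z `<=` h -> #|` z| <= 2 -> bdry h z.
  by move=> z0 zh z2; split=> //; rewrite fproperEcard zh; lia.
move=> x y hx hy; have [[x0 xh] [y0 yh]] := (hx, hy).
have [[a ax] [b bY]] := (fset0Pn _ x0, fset0Pn _ y0).
have [ah bh] := (fsubsetP (fproper_sub xh) _ ax, fsubsetP (fproper_sub yh) _ bY).
have ha : bdry h [fset a].
  by apply: small; rewrite ?fsub1set ?cardfs1 // -cardfs_gt0 cardfs1.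
have hb : bdry h [fset b].
  by apply: small; rewrite ?fsub1set ?cardfs1 // -cardfs_gt0 cardfs1.
have hab : bdry h [fset a; b].
  apply: small; rewrite ?cardfs2 -?cardfs_gt0 ?cardfs2 //; last by case: eqP.
  by apply/fsubsetP => z; rewrite !inE => /orP[]/eqP->.
have [_ xa] : joined (bdry h) [fset a] x /\ joined (bdry h) x [fset a].
  by apply: joined_le => //; rewrite /Order.le /= fsub1set.
have [aab _] := joined_le ha hab (fsubsetUl _ _).
have [_ abb] := joined_le hb hab (fsubsetUr _ _).
have [by' _] : joined (bdry h) [fset b] y /\ joined (bdry h) y [fset b].
  by apply: joined_le => //; rewrite /Order.le /= fsub1set.
exact: joined_trans xa (joined_trans aab (joined_trans abb by')).
Qed.

(** The boundary of a simplex is a sphere: for a proper face g, the faces below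
    g form the boundary of g, those above form a copy of the boundary of the
    opposite face, and the join of the two is [thetao]. *)
Lemma mfdS_bdry h : mfdS #|` h|.-1 (bdry h).
Proof.
have [k] := ubnP #|` h|; elim: k h => // k IHk h hk.
case Eh: #|` h|.-1 => [|m].
  apply/seteqP; split=> // x [x0 /fproper_ltn_card xh].
  by move: x0; rewrite -cardfs_gt0; lia.
have hne : h != fset0 by rewrite -cardfs_gt0; lia.
have [a ah] := fset0Pn _ hne.
split.
- exists [fset a]; split; first by rewrite -cardfs_gt0 cardfs1.
  by rewrite fproperEcard fsub1set ah cardfs1; lia.
- move=> g hg; have [g0 gh] := hg; rewrite thetaoU alphao_bdry // betao_bdry //.
  have gc := fproper_ltn_card gh; rewrite -cardfs_gt0 in g0.
  have hgc : (#|` h `\` g| + #|` g| = #|` h|)%N.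
    by rewrite -card_fsetU_disj ?fdisjointDr // fsetDUK // fproper_sub.
  (* each factor loses one vertex to its own boundary, while h has m + 2 *)
  have -> : m = (#|` g|.-1 + #|` h `\` g|.-1)%N by lia.
  apply: mfdS_join; [|by apply: IHk; lia|].
    move=> x _ [_ xg] [y _ <-]; apply: (@lt_le_trans _ {fset V} g) => //.
    exact: fsubsetUr.
  by apply: (mfdS_addr _ _).1; [move=> x; exact: bdry_disj|apply: IHk; lia].
case: m Eh => [|m] Eh; last by apply: bdry_connected; lia.
have /cardfs1P[b hb] : #|` h `\ a| == 1.
  by have := cardfsD1 a h; rewrite ah; lia.
exists [fset a], [fset b].
have hE : h = [fset a; b] by rewrite -(fsetD1K ah) hb.
apply/seteqP; split=> x.
  move=> [x0 xh]; have xc := fproper_ltn_card xh; have xs := fproper_sub xh.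
  have /cardfs1P[c xE] : #|` x| == 1.
    by rewrite -cardfs_gt0 in x0; lia.
  move: xs; rewrite xE fsub1set hE !inE => /orP[]/eqP->; [by left|by right].
move=> xab; have {xab}[c ch ->] : exists2 c, c \in h & x = [fset c].
  case: xab => ->; [exists a|exists b] => //; by rewrite hE !inE eqxx ?orbT.
split; first by rewrite -cardfs_gt0 cardfs1.
by rewrite fproperEcard fsub1set ch cardfs1; lia.
Qed.

End Simplices.

(** * Links in simplicial complexes *)
Section Complexes.
Set Implicit Arguments.
Unset Strict Implicit.
Import Order.TTheory.
Context (V : choiceType).
Implicit Types (X : {fset {fset V}}) (f g h x y : {fset V}) (m n k : nat).
Local Open Scope fset_scope.

Lemma face_card_gt0 X h : simplicial_complex X -> h \in X -> 0 < #|` h|.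
Proof. by move=> [X0 _] /X0; rewrite cardfs_gt0. Qed.

Lemma alphao_complex X h : simplicial_complex X -> h \in X ->
  alphao [set` X] h = bdry h.
Proof.
move=> [X0 Xd] Xh; apply/seteqP; split=> x.
  by move=> /alphaoE[/X0].
move=> [x0 xh]; apply/alphaoE; split=> //.
by apply: (Xd h) => //; exact: fproper_sub.
Qed.

(** In a complex, a set whose union with h is a face is itself a face as soon
    as it is non-empty. *)
Lemma linkP X h x : simplicial_complex X -> h \in X ->
  x \in link X h <-> [/\ x != fset0, [disjoint h & x] & x `|` h \in X].
Proof.
move=> [X0 Xd] Xh; rewrite !inE /= fsetUC; split.
  by move=> /and3P[/X0 x0 hx xhX]; split.
move=> [x0 hx xhX]; rewrite hx xhX (Xd (x `|` h)) // fsubsetUl //.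
Qed.

Lemma link_complex X h : simplicial_complex X -> h \in X ->
  simplicial_complex (link X h).
Proof.
move=> cX Xh; have [X0 Xd] := cX; split; first by move=> x /(linkP _ cX Xh)[].
move=> x y /(linkP _ cX Xh)[x0 hx xhX] yx y0; apply/(linkP _ cX Xh); split=> //.
  exact: fdisjointWr yx hx.
by apply: (Xd _ _ xhX); [exact: fsetSU|rewrite fsetU_eq0 negb_and y0].
Qed.

Lemma betao_link X h : simplicial_complex X -> h \in X ->
  betao [set` X] h = [set (x `|` h)%fset | x in [set` link X h]]%classic.
Proof.
move=> cX Xh; apply/seteqP; split=> y.
  move=> [Xy hy]; have hy' := fproper_sub hy.
  exists (y `\` h); last exact: fsetDUK.
  apply/(linkP _ cX Xh); rewrite fdisjointDr fsetDUK //; split=> //.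
  by rewrite fsetD_eq0; case/andP: hy.
move=> [x /(linkP _ cX Xh)[x0 hx xhX] <-]; split=> //.
change (h `<` x `|` h); rewrite -{1}(fset0U h) fproper_addr ?fproper0 //.
exact: fdisjointX0.
Qed.

Lemma mfdS_link X h m : simplicial_complex X -> h \in X ->
  mfdS m (betao [set` X] h) <-> mfdS m [set` link X h].
Proof.
move=> cX Xh; rewrite betao_link //; apply: iff_sym; apply: mfdS_addr.
by move=> x /(linkP _ cX Xh)[].
Qed.

Lemma below_theta X h : below (alphao [set` X] h) (betao [set` X] h).
Proof. by move=> a b /alphaoE[_ ah] [_ hb]; exact: lt_trans hb. Qed.

(** In the join [thetao X h], the lower factor is the boundary of h; cancelling
    it leaves the upper factor, of index [m - (#|h| - 1)]. *)
Lemma mfdS_betao X h m : simplicial_complex X -> h \in X ->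
  mfdS m.+1 [set` X] -> mfdS (m.+1 - #|` h|) (betao [set` X] h).
Proof.
move=> cX Xh [_ /(_ h Xh) + _]; rewrite thetaoU => Mt.
have h0 := face_card_gt0 cX Xh.
have -> : (m.+1 - #|` h| = m - #|` h|.-1)%N by lia.
apply: (mfdS_join_inv (@below_theta X h) Mt).
by rewrite alphao_complex //; exact: mfdS_bdry.
Qed.

Lemma mfdS_thetao X h m : simplicial_complex X -> h \in X ->
  mfdS m (betao [set` X] h) -> mfdS (#|` h|.-1 + m) (thetao [set` X] h).
Proof.
move=> cX Xh; rewrite thetaoU; apply: mfdS_join; first exact: below_theta.
by rewrite alphao_complex //; exact: mfdS_bdry.
Qed.

(** * Rank and cardinality *)
Lemma rk_card X h : simplicial_complex X -> h \in X -> rk [set` X] h #|` h|.-1.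
Proof.
move=> cX; have [k] := ubnP #|` h|; elim: k h => // k IHk h hk Xh.
have h0 := face_card_gt0 cX Xh; have hA := alphao_complex cX Xh.
case Eh: #|` h|.-1 => [|m].
  by apply: rk_min; rewrite hA; have := mfdS_bdry h; rewrite Eh.
apply: (@rk_succ _ _ _ _ _ (fun x => #|` x|.-1)).
- by move=> x /alphaoE[Xx /fproper_ltn_card xh]; apply: IHk => //; lia.
- have /fset0Pn[a ah] : h != fset0 by rewrite -cardfs_gt0.
  have hc := cardfsD1 a h; rewrite ah in hc.
  exists (h `\ a); last by lia.
  rewrite hA; split; first by rewrite -cardfs_gt0; lia.
  by rewrite fproperEcard fsubD1set; lia.
- move=> x; rewrite hA => -[x0 /fproper_ltn_card xh].
  by rewrite -cardfs_gt0 in x0; lia.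
Qed.

Lemma faceP X h k : simplicial_complex X ->
  face k [set` X] h <-> h \in X /\ #|` h| = k.+1.
Proof.
move=> cX; split=> -[Xh]; have h0 := face_card_gt0 cX Xh; have rh := rk_card cX Xh.
  by move=> /(rk_inj rh); split=> //; lia.
by move=> hk; split=> //; rewrite hk in rh.
Qed.

Lemma has_rank_card X n : simplicial_complex X -> has_rank n [set` X] ->
  (exists2 h, h \in X & #|` h| = n.+1) /\ (forall h, h \in X -> #|` h| <= n.+1).
Proof.
move=> cX [[h Xh hn] Xn]; split.
  by exists h => //; have /(faceP h n cX)[] : face n [set` X] h by [].
move=> g Xg; have [k gk kn] := Xn _ Xg.
by have /(faceP g k cX)[_ ->] : face k [set` X] g by [].
Qed.

Lemma cofaces_betao X f n : simplicial_complex X -> has_rank n.+1 [set` X] ->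
  face n [set` X] f -> cofaces n.+1 X f = betao [set` X] f.
Proof.
move=> cX /(has_rank_card cX)[_ Xn] /(faceP _ _ cX)[Xf fn]; apply/seteqP; split=> s.
  move=> [/(faceP _ _ cX)[Xs sn] fs]; split=> //.
  by change (f `<` s); rewrite fproperEcard fs fn sn /=.
move=> [Xs fs]; split; last exact: fproper_sub fs.
apply/(faceP _ _ cX); split=> //.
by have := fproper_ltn_card fs; have := Xn _ Xs; lia.
Qed.

(** * From manifolds to normal pseudomanifolds *)
Lemma mfdS_pure X n h : simplicial_complex X -> mfdS n.+1 [set` X] -> h \in X ->
  exists2 s, face n [set` X] s & h `<=` s.
Proof.
move=> cX MX Xh; have [g gmax hg] := mfdS_maximal MX Xh; exists g => //.
by have [_ rkm] := mfdS_rk MX; split; [case: gmax|exact: rkm].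
Qed.

Lemma joined_ridges X n
    (Y := [set u | face n [set` X] u \/ face n.+1 [set` X] u]%classic) :
  simplicial_complex X -> forall s t, face n.+1 [set` X] s ->
  joined ([set` X] `&` Y)%classic s t <->
  exists p, [/\ path_in [set` X] s p, last s p = t & forall u, u \in p -> Y u].
Proof.
by move=> cX s t sF; apply: path_in_joined; [case: sF|right].
Qed.

(** Strong connectedness is the point. Inside the star of one face x, two
    facets are joined by ridges and facets because the link of x is a
    pseudomanifold, by induction ([star] in the proof). Consecutive faces of an
    arbitrary path are comparable, hence contained in a common star, and purity
    provides a facet above each of them at which the pieces are glued. *)
Lemma mfdS_pseudomanifold X n : simplicial_complex X ->
  mfdS n.+2 [set` X] -> pseudomanifold n.+1 X.
Proof.
have [k] := ubnP n; elim: k n X => // k IHk n X nk cX MX.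
have rX : has_rank n.+1 [set` X] by exact: mfdS_rankS MX.
have pX h := @mfdS_pure X n.+1 h cX MX.
split=> //; split=> //.
  move=> f fF; have [Xf fn] := (faceP f n cX).1 fF.
  have := mfdS_betao cX Xf MX; rewrite fn subSS subSnn (cofaces_betao cX rX fF).
  move=> [_ _ [x [y ->]]]; have [->|nxy] := eqVneq x y.
    by left; exists y; rewrite setUid.
  by right; exists x, y.
set Y := ([set` X] `&` [set u | face n [set` X] u \/ face n.+1 [set` X] u])%classic.
have Yface u : face n [set` X] u \/ face n.+1 [set` X] u -> Y u.
  by move=> uF; split=> //; case: uF => -[].
have star x : x \in X -> forall s t, face n.+1 [set` X] s -> face n.+1 [set` X] t ->
    x `<=` s -> x `<=` t -> joined Y s t.
  move=> Xx s t sF tF xs xt.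
  have [Ys Yt] := (Yface _ (or_intror sF), Yface _ (or_intror tF)).
  have [Xs sn] := (faceP s _ cX).1 sF; have [Xt tn] := (faceP t _ cX).1 tF.
  have [_ /(_ x Xx) xn] := has_rank_card cX rX.
  have [xE|[xE|xE]] : #|` x| = n.+2 \/ #|` x| = n.+1 \/ #|` x| <= n by lia.
  (* by codimension of x: 0 forces s = x = t; 1 gives the path s, x, t; the
     other cases go through the link of x *)
  - have /eqP <- : x == s by rewrite eqEfcard xs sn xE /=.
    have /eqP <- : x == t by rewrite eqEfcard xt tn xE /=.
    by apply: joined_refl; apply: Yface; right; apply/faceP.
  - have Yx : Y x by apply: Yface; left; apply/faceP.
    have [_ sx] := joined_le Yx Ys xs; have [tx _] := joined_le Yx Yt xt.
    exact: joined_trans sx tx.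
  - have /(mfdS_link _ cX Xx) := mfdS_betao cX Xx MX.
    have cL := link_complex cX Xx; have x0 := face_card_gt0 cX Xx.
    have -> : (n.+2 - #|` x| = (n - #|` x|).+2)%N by lia.
    move=> /(IHk (n - #|` x|)%N _ _ cL) [|_ _ [_ _ Lc]]; first by lia.
    have LF u : face n.+1 [set` X] u -> x `<=` u ->
        face (n - #|` x|).+1 [set` link X x] (u `\` x).
      move=> /(faceP _ _ cX)[Xu un] xu; apply/faceP => //.
      have := card_fsetU_disj (fdisjointDr x u); rewrite fsetDUK // => uc.
      split; last by lia.
      apply/(linkP _ cX Xx); rewrite fsetDUK // fdisjointDr; split=> //.
      by rewrite -cardfs_gt0; lia.
    have /(joined_ridges cL _ (LF _ sF xs)) := Lc _ _ (LF _ sF xs) (LF _ tF xt).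
    rewrite -{2}(fsetDUK xs) -{2}(fsetDUK xt).
    apply: (joined_map (f := fun u => u `|` x)).
      move=> u [Lu uF]; have [u0 xu uxX] := (linkP u cX Xx).1 Lu.
      have uc := card_fsetU_disj xu; apply: Yface.
      by case: uF => /(faceP _ _ cL)[_ uE]; [left|right]; apply/(faceP _ _ cX);
        split=> //; lia.
    by move=> u v _ _ /fproper_sub uv; exact: fsetSU.
(* [R] speaks of all facets above the two ends, so that the facet chosen over
   an intermediate face does not matter when two pieces are composed *)
pose R x y := [/\ x \in X, y \in X & forall s t, face n.+1 [set` X] s ->
  face n.+1 [set` X] t -> x `<=` s -> y `<=` t -> joined Y s t].
have RX : forall x y, joined [set` X] x y -> R x y.
  apply: joined_ind => [x Xx|x y z [Xx Xy Rxy] [_ Xz Ryz]|x y Xx Xy /fproper_sub xy].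
  - by split=> // s t; exact: star.
  - split=> // s t sF tF xs zt; have [u uF yu] := pX _ Xy.
    exact: joined_trans (Rxy _ _ sF uF xs yu) (Ryz _ _ uF tF yu zt).
  - split; split=> // s t sF tF xs yt; apply: (star x) => //.
      exact: fsubset_trans yt.
    exact: fsubset_trans xs.
move=> s t sF tF; apply/(joined_ridges cX t sF).
have [_ _ Xc] := MX; have [_ _] := RX _ _ (Xc s t sF.1 tF.1); exact.
Qed.

Lemma mfdS_normal X n : simplicial_complex X ->
  mfdS n.+2 [set` X] -> normal_pseudomanifold n.+1 X.
Proof.
move=> cX MX; split; first exact: mfdS_pseudomanifold.
move=> h Xh; rewrite /sdim => hn; have h0 := face_card_gt0 cX Xh.
exists (n - #|` h|).+1; apply: mfdS_pseudomanifold; first exact: link_complex.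
have -> : ((n - #|` h|).+2 = n.+2 - #|` h|)%N by lia.
by apply/mfdS_link => //; exact: mfdS_betao.
Qed.

(** * From normal pseudomanifolds to manifolds *)
Lemma link_link X h g : simplicial_complex X -> h \in X -> g \in link X h ->
  link (link X h) g = link X (g `|` h).
Proof.
move=> cX Xh Lg; have [g0 hg ghX] := (linkP g cX Xh).1 Lg.
have cL := link_complex cX Xh; apply/fsetP => x; apply/idP/idP.
  move=> /(linkP x cL Lg)[x0 gx /(linkP _ cX Xh)[_ hxg xghX]].
  apply/(linkP _ cX ghX); split; rewrite ?fsetUA // fdisjointUX gx /=.
  exact: fdisjointWr (fsubsetUl _ _) hxg.
move=> /(linkP x cX ghX)[x0]; rewrite fdisjointUX fsetUA => /andP[gx hx] xghX.
apply/(linkP _ cL Lg); split=> //; apply/(linkP _ cX Xh); split=> //.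
  by rewrite fsetU_eq0 negb_and x0.
by rewrite fdisjointXU hx.
Qed.

(** Normality does not prescribe the rank of a link; purity does: a facet of X
    containing h gives a face of cardinality [n.+1 - #|h|] in the link, and no
    face of the link can be larger. *)
Lemma normal_link X n h : normal_pseudomanifold n X -> h \in X ->
  #|` h| < n -> normal_pseudomanifold (n - #|` h|) (link X h).
Proof.
case: n => // n [[cX rX [pX _ _]] nX] Xh hn; have h0 := face_card_gt0 cX Xh.
have cL := link_complex cX Xh.
have [|m pL] := nX _ Xh; first by rewrite /sdim; lia.
have mE : m = (n.+1 - #|` h|)%N.
  have [_ rL _] := pL; have [[g Lg gm] Lm] := has_rank_card cL rL.
  have [_ Xn] := has_rank_card cX rX.
  have [s /(faceP _ _ cX)[Xs sn] hs] := pX _ Xh.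
  have sc := card_fsetU_disj (fdisjointDr h s); rewrite fsetDUK // in sc.
  have /Lm sm : s `\` h \in link X h.
    apply/(linkP _ cX Xh); rewrite fsetDUK // fdisjointDr; split=> //.
    by rewrite -cardfs_gt0; lia.
  have [_ hg ghX] := (linkP g cX Xh).1 Lg.
  by have := card_fsetU_disj hg; have := Xn _ ghX; lia.
rewrite -mE; split=> // g Lg; rewrite /sdim => gm.
have [_ hg ghX] := (linkP g cX Xh).1 Lg; have gc := card_fsetU_disj hg.
by rewrite link_link //; apply: nX => //; rewrite /sdim; lia.
Qed.

(** The upper part of a face h is empty if h is a facet, the one or two
    cofaces if h is a ridge, and a copy of a normal pseudomanifold of smaller
    rank otherwise. *)
Lemma normal_mfdS X n : normal_pseudomanifold n X -> mfdS n.+1 [set` X].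
Proof.
have [k] := ubnP n; elim: k n X => // k IHk [|n] X nk NX; have [[cX rX pX] nX] := NX.
  case: pX => h ->; apply: (@mfdS_1 _ _ h h); first by rewrite setUid set_fset1.
  by move=> a b /=; rewrite !inE => /eqP-> /eqP->; rewrite ltxx.
have [pure ridge strong] := pX; have [[s Xs _] Xn] := has_rank_card cX rX.
split; first by exists s.
  move=> h Xh; have h0 := face_card_gt0 cX Xh; have hn := Xn _ Xh.
  have -> : n.+1 = (#|` h|.-1 + (n.+2 - #|` h|))%N by lia.
  apply: mfdS_thetao => //.
  have [hE|[hE|hE]] : #|` h| = n.+2 \/ #|` h| = n.+1 \/ #|` h| < n.+1 by lia.
  - rewrite hE subnn; apply/seteqP; split=> // x [Xx /fproper_ltn_card].
    by have := Xn _ Xx; lia.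
  - have hF : face n [set` X] h by apply/faceP.
    have [x [y xyE]] : exists x y, cofaces n.+1 X h = [set x; y]%classic.
      have [[x ->]|[x [y [_ ->]]]] := ridge _ hF; last by exists x, y.
      by exists x, x; rewrite setUid.
    rewrite hE subSS subSnn -(cofaces_betao cX rX hF); apply: (mfdS_1 xyE).
    move=> a b [/(faceP _ _ cX)[_ an] _] [/(faceP _ _ cX)[_ bn] _].
    by apply/negP => /fproper_ltn_card; lia.
  - apply/mfdS_link => //; have -> : (n.+2 - #|` h| = (n.+1 - #|` h|).+1)%N by lia.
    by apply: IHk; [lia|exact: normal_link].
move=> x y Xx Xy; have [s' sF xs] := pure _ Xx; have [t tF yt] := pure _ Xy.
have [p [sp pt _]] := strong _ _ sF tF.
have st : joined [set` X] s' t by exists p.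
have [xs' _] := joined_le Xx sF.1 xs; have [_ ty] := joined_le Xy tF.1 yt.
exact: joined_trans xs' (joined_trans st ty).
Qed.

(** Without edges every [thetao] is empty, so a non-empty border forces
    [0 < n]. *)
Lemma border_rank0 X : simplicial_complex X -> has_rank 0 [set` X] ->
  border 0 [set` X] = set0.
Proof.
move=> cX /(has_rank_card cX)[_ X1]; apply/seteqP; split=> // h [Xh]; apply=> /=.
suff -> : thetao [set` X] h = set0 by split=> //; exact: finite_CF_order.
apply/seteqP; split=> // x /thetaoE[Xx lt].
have [x1 h1] := (X1 _ Xx, X1 _ Xh).
have [x0 h0] := (face_card_gt0 cX Xx, face_card_gt0 cX Xh).
by case: lt => /fproper_ltn_card; lia.
Qed.

End Complexes.

(** * The two cases of the border *)
Lemma surfaceS_border (d : Order.disp_t) (T : porderType d) (X : set T) (n : nat) :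
  surfaceS n.+2 X -> border n.+1 X = set0.
Proof. by move=> [_ [_ _ Xt]]; apply/seteqP; split=> // h [/Xt]. Qed.

Lemma pcmS_border (d : Order.disp_t) (T : porderType d) (X : set T) (n : nat) :
  pcmS n.+2 X -> border n.+1 X <> set0.
Proof. by move=> [_ [_ [h hb] _]] b0; rewrite b0 in hb. Qed.

Theorem theorem3 (V : choiceType) (X : {fset {fset V}}) (n : nat)
    (hX : simplicial_complex X) (hn : has_rank n [set` X]) :
  ((border n [set` X] = set0 /\
      (0 < n -> (discrete_surface [set` X] <-> normal_pseudomanifold n X)))
   \/
   (border n [set` X] <> set0 /\
      (pcm n [set` X] <-> normal_pseudomanifold n X)))
  /\
  (normal_pseudomanifold n X -> discrete_surface [set` X] \/ pcm n [set` X]).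
Proof.
have SP : normal_pseudomanifold n X -> surfaceS n.+1 [set` X] \/ pcm n [set` X].
  by move=> /normal_mfdS; apply: mfdS_surfaceS_pcmS; exact: finite_fset.
split; last by move=> /SP[sX|]; [left; exists n.+1|right].
have [b0|bn0] := pselect (border n [set` X] = set0); [left|right]; split=> //.
  case: n hn SP b0 => // n hn SP b0 _; split.
    move=> [m /surfaceS_mfdS MX].
    have mE : m = n.+2 := rankS_inj (mfdS_rankS MX) hn.
    by apply: mfdS_normal => //; rewrite -mE.
  by move=> /SP[sX|/pcmS_border//]; exists n.+2.
case: n hn SP bn0 => [/(border_rank0 hX)//|n _ SP bn0]; split.
  by move=> /pcmS_mfdS; exact: mfdS_normal.
by move=> /SP[/surfaceS_border|].
Qed.
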